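(* Let $F:\mathbb{R}^n\to\mathbb{R}^n$ be continuous and let $K:\mathbb{R}^n\rightrightarrows\mathbb{R}^n$ be inner semicontinuous with closed graph, closed convex values and $\operatorname{dom}K=\mathbb{R}^n$. Assume that either $K$ is compact-valued or $F$ is monotone. Let $\bar x$ be a solution of the QVI: find $x\in K(x)$ such that $\langle F(x),z-x\rangle\ge0$ for all $z\in K(x)$. Let $\mu,\mu^\perp>0$ with $\mu\mu^\perp<1$ be such that the mapping $\mathbf{T}(x_1,x_2)=(F(x_1)+N_{K(x_2)}(x_1))\times\{0\}$ is $(\mu^\perp,\mu)$-semimonotone at $((\bar x,\bar x),\mathbf 0)$ on $\mathbb{R}^{2n}\times\mathbb{R}^{2n}$ with respect to $\mathbf{S}=\{(x_1,x_2)\in\mathbb{R}^n\times\mathbb{R}^n:x_1=x_2\}$. Let the parameters of Algorithm 2 (see context) satisfy $$r\in(\mu^\perp,1/\mu),\qquad\lambda_x\in(0,2(1-r\mu)),\qquad\lambda_y\in(0,2(1-\mu^\perp/r)).$$ Then the following hold, for any starting points $x^0,y^0\in\mathbb{R}^n$. (i) Suppose $\mathbf{M}_{\rm VI}$ is single-valued on $\mathbb{R}^n\times\mathbb{R}^n$ and there exist $L_p,L_q\ge0$ with $L_q<1/2$ such that $\|\mathbf{M}_{\rm VI}(p,q)-\mathbf{M}_{\rm VI}(0,\bar x)\|\le L_p\|p\|+L_q\|q-\bar x\|$ for all $p,q\in\mathbb{R}^n$. Then either a solution of the QVI is reached in a finite number of iterations, or the generated sequence $\{x^k\}$ is bounded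 and every accumulation point of it is a solution of the QVI. In particular, if $\bar x$ is the unique solution of the QVI, then the sequence converges to $\bar x$. (ii) Suppose $\mathbf{M}_{\rm QVI}$ is single-valued on $\mathbb{R}^n\times\mathbb{R}^n$ and there exist $L_p,L_q\ge0$ with $L_q<1$ such that $\|\mathbf{M}_{\rm QVI}(p,q)-\mathbf{M}_{\rm QVI}(0,0)\|\le L_p\|p\|+L_q\|q\|$ for all $p,q\in\mathbb{R}^n$. Then the generated sequence $\{x^k\}$ reaches a solution in a finite number of iterations or converges to the (unique in this case) QVI solution $\bar x$.
   Context: $\|\cdot\|$, $\langle\cdot,\cdot\rangle$ are Euclidean. For a set-valued mapping $\Phi$, $\operatorname{gph}\Phi=\{(x,u):u\in\Phi(x)\}$, $\operatorname{dom}\Phi=\{x:\Phi(x)\ne\emptyset\}$. $K$ is inner semicontinuous if for every $\bar u\in\operatorname{dom}K$, all sequences $u^k\to\bar u$ and every $\bar v\in K(\bar u)$ there is a sequence $v^k\to\bar v$ with $v^k\in K(u^k)$. For a closed convex set $D$, $N_D(x)=\{v:\langle v,y-x\rangle\le0\ \forall y\in D\}$ if $x\in D$ and $N_D(x)=\emptyset$ otherwise. $F$ is monotone if $\langle F(x)-F(y),x-y\rangle\ge0$ for all $x,y$. VI$(G,D)$ is the problem: find $x\in D$ with $\langle G(x),z-x\rangle\ge0$ for all $z\in D$. Solution mappings: for $p,q\in\mathbb{R}^n$, $$x\in\mathbf{M}_{\rm VI}(p,q)\iff 0\in p+F(x)+N_{K(q)}(x),\qquad x\in\mathbf{M}_{\rm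 QVI}(p,q)\iff0\in p+F(x)+N_{K(x+q)}(x).$$ Single-valued on a set means that the value is a singleton at every point of that set (identified with its element). Semimonotonicity: given $\Phi:\mathbb{R}^m\rightrightarrows\mathbb{R}^m$, a subspace $\mathcal V\subset\mathbb{R}^m$ with orthogonal complement $\mathcal V^\perp$, and $\mu^\perp,\mu>0$, $\Phi$ is $(\mu^\perp,\mu)$-semimonotone (with respect to $\mathcal V$) at $(x^*,y^* )\in\operatorname{gph}\Phi$ on an open set $\mathcal U\ni(x^*,y^* )$ if for all $(x,y)\in\operatorname{gph}\Phi\cap\mathcal U$ $$\langle y-y^*,x-x^*\rangle+\mu^\perp\|\mathbf P_{\mathcal V^\perp}(x)-\mathbf P_{\mathcal V^\perp}(x^* )\|^2+\mu\|\mathbf P_{\mathcal V}(y)-\mathbf P_{\mathcal V}(y^* )\|^2\ge0,$$ where $\mathbf P$ denotes orthogonal projection. Algorithm 2 (progressive decoupling+ for the QVI), with parameters $r,\lambda_x,\lambda_y>0$: given $x^0,y^0\in\mathbb{R}^n$, for $k=0,1,2,\dots$ set $K^k=K(x^k-\frac1ry^k)$, let $\hat x^k$ be a solution of VI$(G_k,K^k)$ with $G_k(u)=F(u)+ru-y^k-rx^k$, and set $$x^{k+1}=(1-\lambda_x)x^k+\lambda_x\cdot\tfrac12\Bigl(\hat x^k+x^k-\tfrac1ry^k\Bigr),\qquad y^{k+1}=y^k-\lambda_y\cdot\tfrac r2\Bigl(\hat x^k-x^k+\tfrac1ry^k\Bigr).$$ (The stopping test is disregarded when discussing convergence.) *)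

(* Defs.v *)
From HB Require Import structures.
From mathcomp Require Import all_boot all_order all_algebra.
From mathcomp Require Import all_classical all_reals all_analysis.
Import Order.TTheory GRing.Theory Num.Theory.
Import numFieldNormedType.Exports.

Set Implicit Arguments.
Unset Strict Implicit.
Unset Printing Implicit Defensive.

Local Open Scope classical_set_scope.
Local Open Scope ring_scope.

(* [`|x|] on ['rV[R]_n] is the sup norm. It induces the same topology and the
   same bounded sets as the Euclidean norm, so the library's notions of
   convergence, closedness, compactness and boundedness are used as they are;
   norms occurring in inequalities are Euclidean. *)
Section Euclidean.
Variables (R : realType) (n : nat).
Implicit Types (u v : 'rV[R]_n) (D : set 'rV[R]_n).

Definition dot u v : R := \sum_i u 0 i * v 0 i.

Definition enorm u : R := Num.sqrt (dot u u).

Definition monotone_map (F : 'rV[R]_n -> 'rV[R]_n) : Prop :=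
  forall u v, 0 <= dot (F u - F v) (u - v).

Definition normal_cone D u : set 'rV[R]_n :=
  [set v | D u /\ forall z, D z -> dot v (z - u) <= 0].

Definition VI_sol (G : 'rV[R]_n -> 'rV[R]_n) D : set 'rV[R]_n :=
  [set u | D u /\ forall z, D z -> 0 <= dot (G u) (z - u)].

End Euclidean.

Section SetValued.
Variables T U : Type.

Definition gph (Phi : T -> set U) : set (T * U) := [set z | Phi z.1 z.2].

Definition dom (Phi : T -> set U) : set T := [set t | Phi t !=set0].

End SetValued.

Definition inner_semicontinuous (T U : topologicalType) (K : T -> set U) : Prop :=
  forall (ubar : T) (u : nat -> T) (vbar : U),
    dom K ubar -> u @ \oo --> ubar -> K ubar vbar ->
  exists v : nat -> U, v @ \oo --> vbar /\ forall k, K (u k) (v k).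

(* A linear subspace of R^m is the row space of a matrix [V] with [m] columns,
   and linear maps act on row vectors from the right. *)
Section Semimonotone.
Variables (R : realType) (m : nat).

Definition orth_compl p (V : 'M[R]_(p, m)) : 'M[R]_m := orthomx idfun 1%:M V.

Definition orth_proj p (V : 'M[R]_(p, m)) (x : 'rV[R]_m) : 'rV[R]_m :=
  x *m proj_mx <<V>>%MS (orth_compl V).

Definition semimonotone p (V : 'M[R]_(p, m)) (muperp mu : R)
    (Phi : 'rV[R]_m -> set 'rV[R]_m) (xs ys : 'rV[R]_m)
    (O : set ('rV[R]_m * 'rV[R]_m)) : Prop :=
  [/\ gph Phi (xs, ys), open O, O (xs, ys) &
    forall x y, (gph Phi `&` O) (x, y) ->
      0 <= dot (y - ys) (x - xs)
         + muperp * enorm (orth_proj (orth_compl V) x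
                           - orth_proj (orth_compl V) xs) ^+ 2
         + mu * enorm (orth_proj V y - orth_proj V ys) ^+ 2].

Lemma orth_complP p (V : 'M[R]_(p, m)) (u : 'rV[R]_m) :
  (u <= orth_compl V)%MS <->
  forall v : 'rV[R]_m, (v <= V)%MS -> dot u v = 0.
Proof.
have dotE (v w : 'rV[R]_m) : dot v w = (v *m w^T) 0 0.
  by rewrite mxE; apply: eq_bigr => i _; rewrite mxE.
rewrite /orth_compl /orthomx map_mx_id // mul1mx.
split=> [/sub_kermxP uV v /submxP[a ->]|uV].
  by rewrite dotE trmx_mul mulmxA uV mul0mx mxE.
apply/sub_kermxP/rowP => i; have := uV _ (row_sub i V); rewrite dotE => uVi.
by rewrite [RHS]mxE -[RHS]uVi !mxE; apply: eq_bigr => j _; rewrite !mxE.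
Qed.

Lemma orth_compl_cap p (V : 'M[R]_(p, m)) : (<<V>> :&: orth_compl V)%MS = 0.
Proof.
apply/eqP/rowV0P => v; rewrite sub_capmx genmxE => /andP[vV /orth_complP vo].
have /eqP := vo v vV; rewrite psumr_eq0; last by move=> i _; exact: sqr_ge0.
move=> /allP v0; apply/rowP => i; rewrite mxE; apply/eqP.
by have := v0 i (mem_index_enum i); rewrite mulf_eq0 orbb.
Qed.

Lemma orth_compl_add p (V : 'M[R]_(p, m)) (x : 'rV[R]_m) :
  (x <= <<V>> + orth_compl V)%MS.
Proof.
apply: (submx_trans (submx1 x)); rewrite sub1mx /row_full.
have /mxdirectP/= -> : mxdirect (<<V>> + orth_compl V).
  by rewrite mxdirect_addsE /= !mxdirectE /= orth_compl_cap !eqxx.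
rewrite genmxE /orth_compl /orthomx map_mx_id // mul1mx mxrank_ker mxrank_tr.
by rewrite subnKC ?rank_leq_col.
Qed.

Lemma orth_projP p (V : 'M[R]_(p, m)) (x : 'rV[R]_m) :
  (orth_proj V x <= V)%MS /\ (x - orth_proj V x <= orth_compl V)%MS.
Proof.
split; first by rewrite (submx_trans (proj_mx_sub _ _ _)) // genmxE.
exact: proj_mx_compl_sub (orth_compl_add V x).
Qed.

End Semimonotone.

Section QVI.
Variables (R : realType) (n : nat).
Variables (F : 'rV[R]_n -> 'rV[R]_n) (K : 'rV[R]_n -> set 'rV[R]_n).

Definition QVI_sol : set 'rV[R]_n := [set x | VI_sol F (K x) x].

Definition M_VI (p q : 'rV[R]_n) : set 'rV[R]_n :=
  [set x | [set p + F x + v | v in normal_cone (K q) x] 0].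

Definition M_QVI (p q : 'rV[R]_n) : set 'rV[R]_n :=
  [set x | [set p + F x + v | v in normal_cone (K (x + q)) x] 0].

(* R^n x R^n is ['rV[R]_(n + n)], a pair (x1, x2) being [row_mx x1 x2]. *)
Definition T_QVI (z : 'rV[R]_(n + n)) : set 'rV[R]_(n + n) :=
  let x1 := lsubmx z in let x2 := rsubmx z in
  [set row_mx (F x1 + v) 0 | v in normal_cone (K x2) x1].

(* [xhat k] is an arbitrary solution of the k-th subproblem, which need not be
   unique. *)
Definition PD_plus_QVI (r lx ly : R) (x y xhat : nat -> 'rV[R]_n) : Prop :=
  forall k,
    [/\ VI_sol (fun u => F u + r *: u - y k - r *: x k)
               (K (x k - r^-1 *: y k)) (xhat k),
        x k.+1 = (1 - lx) *: x k
                 + (lx / 2) *: (xhat k + x k - r^-1 *: y k) &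
        y k.+1 = y k - (ly * (r / 2)) *: (xhat k - x k + r^-1 *: y k)].

End QVI.

Definition diag_space (R : realType) (n : nat) : 'M[R]_(n, n + n) :=
  row_mx 1%:M 1%:M.

Lemma diag_spaceP (R : realType) (n : nat) (z : 'rV[R]_(n + n)) :
  (z <= diag_space R n)%MS <-> lsubmx z = rsubmx z.
Proof.
split=> [/submxP[a ->]|e].
  by rewrite mul_mx_row row_mxKl row_mxKr.
apply/submxP; exists (lsubmx z).
by rewrite mul_mx_row mulmx1 {2}e hsubmxK.
Qed.

Definition single_valued (T U W : Type) (M : T -> U -> set W) : Prop :=
  forall p q, exists w, M p q = [set w].

(* Main.v *)
Require Import Defs.
From HB Require Import structures.
From mathcomp Require Import all_boot all_order all_algebra.
From mathcomp Require Import all_classical all_reals all_analysis.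
From mathcomp Require Import ring.
Import Order.TTheory GRing.Theory Num.Theory.
Import numFieldNormedType.Exports.
Local Open Scope classical_set_scope.
Local Open Scope ring_scope.

(** The method is a relaxed resolvent iteration for [T] in which the step along
    [S] and the step along its orthogonal complement have their own relaxation
    parameters.  Put
      [a = x - y / r],  [w = y + r x - r xhat],  [d = xhat - a].
    Solving the subproblem says that [(w, 0)] belongs to [T (xhat, a)], and the
    updates are
      [x' = x - lx / (2 r) w],  [y' = y - ly r / 2 d],  with [2 y = w + r d].
    Semimonotonicity at [((xbar, xbar), 0)], where the projections of
    [(xhat, a)] and [(w, 0)] are half differences and half sums
    ([semimonotone_diag]), is a lower bound on [<w, xhat - xbar>].  It is
    exactly what makes
      [V = r / lx |x - xbar|^2 + 1 / (ly r) |y|^2]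
    decrease by at least [c1 |w|^2 + c2 |d|^2], and the parameter ranges are
    those for which [c1] and [c2] are positive ([PD_descent]).

    Hence [x] is bounded and [w], [d] tend to [0]; since [2 y = w + r d], so
    does [y].  Along a subsequence with [x --> z], also [a] and [xhat] tend to
    [z], while [xhat] solves the variational inequality over [K a] up to the
    perturbation [w --> 0].  Closedness of the graph of [K] gives [z \in K z],
    and inner semicontinuity lets any competitor in [K z] be approximated by
    competitors in [K a], so the inequality passes to the limit
    ([VI_sol_limit]): every accumulation point of [x] solves the QVI.

    A bounded sequence with a single accumulation point converges, which gives
    convergence to [xbar] when [xbar] is the only solution.  In part (ii) this
    uniqueness is single-valuedness at [(0, 0)], because [M_QVI 0 0] is the
    solution set. *)

(** * Euclidean inner product and norm *)

Section Dot.
Context {R : realType} {n : nat}.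
Implicit Types (u v w : 'rV[R]_n) (c : R).

Lemma dotC u v : dot u v = dot v u.
Proof. by apply: eq_bigr => i _; rewrite mulrC. Qed.

Lemma dotDl u v w : dot (u + v) w = dot u w + dot v w.
Proof. by rewrite -big_split; apply: eq_bigr => i _; rewrite mxE mulrDl. Qed.

Lemma dotZl c u v : dot (c *: u) v = c * dot u v.
Proof. by rewrite mulr_sumr; apply: eq_bigr => i _; rewrite mxE mulrA. Qed.

Lemma dotNl u v : dot (- u) v = - dot u v.
Proof. by rewrite -scaleN1r dotZl mulN1r. Qed.

Lemma dotDr u v w : dot w (u + v) = dot w u + dot w v.
Proof. by rewrite dotC dotDl !(dotC w). Qed.

Lemma dotZr c u v : dot u (c *: v) = c * dot u v.
Proof. by rewrite dotC dotZl dotC. Qed.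

Lemma dotNr u v : dot u (- v) = - dot u v.
Proof. by rewrite dotC dotNl dotC. Qed.

Definition dotE := (dotDl, dotDr, dotNl, dotNr, dotZl, dotZr).

Lemma dot0l v : dot 0 v = 0.
Proof. by rewrite -(scale0r 0) dotZl mul0r. Qed.

Lemma dot_ge0 u : 0 <= dot u u.
Proof. by apply: sumr_ge0 => i _; exact: sqr_ge0. Qed.

Lemma enorm_sq u : enorm u ^+ 2 = dot u u.
Proof. by rewrite sqr_sqrtr ?dot_ge0. Qed.

(** Transfers Euclidean estimates to the sup norm that carries the topology. *)
Lemma norm_le_enorm u : `|u| <= enorm u.
Proof.
change (mx_norm u <= enorm u).
have [->|/mx_norm_neq0[[i j] ->]] := eqVneq (mx_norm u) 0; first exact: sqrtr_ge0.
rewrite /= ord1 -sqrtr_sqr ler_sqrt ?dot_ge0// /dot (bigD1 j)//=.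
by rewrite expr2 lerDl sumr_ge0// => k _; exact: sqr_ge0.
Qed.

Lemma cvg_dot (u v : nat -> 'rV[R]_n) (a b : 'rV[R]_n) :
  u @ \oo --> a -> v @ \oo --> b -> (fun k => dot (u k) (v k)) @ \oo --> dot a b.
Proof.
move=> ua vb; apply: cvg_big => [|i _]; first exact: add_continuous.
apply: cvgM; first exact: (cvg_comp _ _ ua (@coord_continuous R 1 n 0 i a)).
exact: (cvg_comp _ _ vb (@coord_continuous R 1 n 0 i b)).
Qed.

Lemma cvg_dot_self0 (u : nat -> 'rV[R]_n) :
  (fun k => dot (u k) (u k)) @ \oo --> (0 : R) -> u @ \oo --> (0 : 'rV[R]_n).
Proof.
move=> u0; apply/norm_cvg0P.
have su0 : (fun k => enorm (u k)) @ \oo --> (0 : R).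
  rewrite -[X in _ --> X]sqrtr0.
  exact: (cvg_comp _ _ u0 (@sqrt_continuous R 0)).
apply: (squeeze_cvgr _ (cvg_cst 0) su0).
by apply: nearW => k; rewrite normr_ge0 norm_le_enorm.
Qed.

End Dot.

(** * Projections onto the diagonal and its complement *)

Lemma dot_row_mx {R : realType} {n1 n2 : nat} (a c : 'rV[R]_n1) (b d : 'rV[R]_n2) :
  dot (row_mx a b) (row_mx c d) = dot a c + dot b d.
Proof.
rewrite /dot big_split_ord /=.
by congr (_ + _); apply: eq_bigr => i _; rewrite ?row_mxEl ?row_mxEr.
Qed.

Lemma orth_projDE {R : realType} {m p : nat} (V : 'M[R]_(p, m)) (a b : 'rV[R]_m) :
  (a <= V)%MS -> (b <= orth_compl V)%MS -> orth_proj V (a + b) = a.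
Proof.
move=> aV bV; rewrite /orth_proj mulmxDl.
by rewrite proj_mx_id ?proj_mx_0 ?addr0 ?genmxE // orth_compl_cap.
Qed.

(** With [p] the projection of [x] on [V], the decomposition [(x - p) + p] also
    works for the complement, since [V] is contained in its double
    complement. *)
Lemma orth_proj_compl {R : realType} {m p : nat} (V : 'M[R]_(p, m)) (x : 'rV[R]_m) :
  orth_proj (orth_compl V) x = x - orth_proj V x.
Proof.
have [pV qV] := orth_projP V x.
rewrite -{1}(subrK (orth_proj V x) x); apply: orth_projDE => //.
by apply/orth_complP => v /orth_complP vV; rewrite dotC vV.
Qed.

Lemma orth_proj_diag {R : realType} {n : nat} (a b : 'rV[R]_n) :
  orth_proj (diag_space R n) (row_mx a b)
  = row_mx (2^-1 *: (a + b)) (2^-1 *: (a + b)).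
Proof.
set h := _ *: _.
have -> : row_mx a b = row_mx h h + row_mx (a - h) (b - h).
  by rewrite add_row_mx ![h + _]addrC !subrK.
apply: orth_projDE; first by apply/diag_spaceP; rewrite row_mxKl row_mxKr.
apply/orth_complP => v /diag_spaceP e.
rewrite -(hsubmxK v) e dot_row_mx -dotDl.
suff -> : a - h + (b - h) = 0 by rewrite dot0l.
by apply/rowP => i; rewrite !mxE; field.
Qed.

(** The factors [1 / 2] are the squared lengths of a half sum or a half
    difference placed in both components.  The hypothesis on [u] says that
    [w - F u] is normal to [K a] at [u]. *)
Lemma semimonotone_diag {R : realType} {n : nat} {F : 'rV[R]_n -> 'rV[R]_n}
    {K : 'rV[R]_n -> set 'rV[R]_n} {xbar : 'rV[R]_n} {mu muperp : R} :
  semimonotone (diag_space R n) muperp mu (T_QVI F K) (row_mx xbar xbar) 0 setT ->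
  forall u a w, VI_sol (fun z => F z - w) (K a) u ->
    0 <= dot w (u - xbar) + muperp / 2 * dot (u - a) (u - a) + mu / 2 * dot w w.
Proof.
move=> [_ _ _ hT] u a w [uKa VIu].
have /hT : (gph (T_QVI F K) `&` setT) (row_mx u a, row_mx w 0).
  split=> //=; rewrite /gph /T_QVI /= row_mxKl row_mxKr.
  exists (w - F u); last by rewrite addrCA subrr addr0.
  split=> // z zKa; have := VIu z zKa.
  by rewrite -[w - F u]opprB dotNl oppr_le0.
rewrite !orth_proj_compl !enorm_sq subr0 -(row_mx0 R 1 n n).
rewrite !orth_proj_diag !opp_row_mx !add_row_mx !dot_row_mx dot0l.
move=> /le_trans; apply.
rewrite le_eqVlt; apply/orP; left; apply/eqP.
have ul (s t : 'rV[R]_n) : s - 2^-1 *: (s + t) = 2^-1 *: (s - t).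
  by apply/rowP => i; rewrite !mxE; field.
have ur (s t : 'rV[R]_n) : t - 2^-1 *: (s + t) = - (2^-1 *: (s - t)).
  by apply/rowP => i; rewrite !mxE; field.
rewrite !ul !ur !subrr !addr0 !scaler0 row_mx0 !subr0 dot_row_mx !dotE.
by field.
Qed.

(** * Sequences *)

(** Inner semicontinuity speaks of sequences, so accumulation points have to be
    reached by sequences rather than filters. *)
Lemma cluster_subsequence {R : realType} {n : nat} (u : nat -> 'rV[R]_n)
    (z : 'rV[R]_n) :
  cluster (u @ \oo) z ->
  exists f : nat -> nat, f @ \oo --> \oo /\ u \o f @ \oo --> z.
Proof.
move=> cz.
have ex_f j : exists k, (j <= k)%N /\ ball z j.+1%:R^-1 (u k).
  have uA : (u @ \oo) [set u k | k in [set k | (j <= k)%N]].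
    by exists j => // k /= jk; exists k.
  have [|_ [[k jk <-] kB]] := cz _ (ball z j.+1%:R^-1) uA.
    by apply: nbhsx_ballx; rewrite invr_gt0.
  by exists k.
have [f fP] := choice ex_f; exists f; split.
  apply/cvgnyPge => A; exists A => // k /= Ak.
  exact: leq_trans Ak (fP k).1.
apply/cvgrPdist_lt => e e0.
near=> j; have := (fP j).2; rewrite -ball_normE /= => /lt_trans; apply.
near: j; exact: (near_infty_natSinv_lt (PosNum e0)).
Unshelve. all: by end_near. Qed.

Lemma le_bounded_set {R : realType} {n : nat} (A : set 'rV[R]_n) (M : R) :
  (forall v, A v -> `|v| <= M) -> bounded_set A.
Proof.
move=> AM; exists M; split; first exact: num_real.
by move=> N MN v Av; rewrite /= (le_trans (AM v Av))// ltW.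
Qed.

Lemma bounded_cluster_sub1_cvg {R : realType} {n : nat} {u : nat -> 'rV[R]_n}
    {a : 'rV[R]_n} {M : R} :
  (forall k, `|u k - a| <= M) -> cluster (u @ \oo) `<=` [set a] -> u @ \oo --> a.
Proof.
(* The radius is [`|M| + 1] so that the ball is a neighbourhood of [a] whatever
   the sign of [M]. *)
move=> uM ca; set V := closed_ball a (`|M| + 1).
have M0 : 0 < `|M| + 1 by rewrite ltr_pwDr.
have VE : V = closed_ball_ Num.norm a (`|M| + 1) by rewrite /V closed_ballE.
have cV : compact V.
  apply: bounded_closed_compact; last exact: closed_ball_closed.
  apply: (le_bounded_set _ (`|a| + (`|M| + 1))) => v; rewrite VE /closed_ball_ /= => av.
  by rewrite -(subKr a v) (le_trans (ler_normB _ _))// lerD2l.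
have uV : (u @ \oo) V.
  exists 0%N => // k _; rewrite /= VE /closed_ball_ /= distrC.
  by rewrite (le_trans (uM k))// (le_trans (ler_norm _))// lerDl.
apply: (compact_cluster_set1 _ cV) => //.
- apply: filterS (nbhsx_ballx a _ M0); exact: subset_closed_ball.
- apply/seteqP; split=> // _ ->.
  by have [p [_ cp]] := cV _ _ uV; rewrite -(ca _ cp).
Qed.

(** A nonnegative nonincreasing [V] converges, hence its decrements, which
    dominate [c * g], tend to [0]. *)
Lemma decrement_cvg0 {R : realType} {V g : nat -> R} {c : R} :
  0 < c -> (forall k, 0 <= V k) -> (forall k, 0 <= g k) ->
  (forall k, V k.+1 + c * g k <= V k) -> g @ \oo --> (0 : R).
Proof.
move=> c0 V0 g0 Vg.
have cV : cvgn V.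
  apply: nonincreasing_is_cvgn; last by exists 0 => _ [k _ <-].
  apply/nonincreasing_seqP => k.
  by rewrite (le_trans _ (Vg k))// lerDl mulr_ge0// ltW.
have d0 : (fun k => c^-1 * (V k - V k.+1)) @ \oo --> (0 : R).
  rewrite -(mulr0 c^-1) -(subrr (limn V)); apply: cvgMr; apply: cvgB => //.
  by rewrite (cvg_shiftS V).
apply: (squeeze_cvgr _ (cvg_cst 0) d0).
by apply: nearW => k; rewrite g0 ler_pdivlMl// lerBrDl Vg.
Qed.

(** * The Lyapunov function *)

(** The weights [r / lx] and [(ly * r)^-1] are chosen so that the first-order
    terms of the two squares add up to [- <w, x - xbar> - <y, d>]; by
    [xhat = x - w / (2 r) + d / 2] and [2 y = w + r d] this differs from
    [- <w, xhat - xbar>] only by multiples of [|w|^2] and [|d|^2]. *)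
Lemma PD_descent {R : realType} {n : nat} (r lx ly mu muperp : R)
    (xbar x y u : 'rV[R]_n) (a := x - r^-1 *: y) (w := y + r *: x - r *: u)
    (x' := (1 - lx) *: x + (lx / 2) *: (u + x - r^-1 *: y))
    (y' := y - (ly * (r / 2)) *: (u - x + r^-1 *: y)) :
  0 < r -> 0 < lx -> 0 < ly ->
  0 <= dot w (u - xbar) + muperp / 2 * dot (u - a) (u - a) + mu / 2 * dot w w ->
  r / lx * dot (x' - xbar) (x' - xbar) + (ly * r)^-1 * dot y' y'
  + (2 * (1 - r * mu) - lx) / (4 * r) * dot w w
  + r * (2 * (1 - muperp / r) - ly) / 4 * dot (u - a) (u - a)
  <= r / lx * dot (x - xbar) (x - xbar) + (ly * r)^-1 * dot y y.
Proof.
move=> r0 lx0 ly0; set d := u - a.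
have rn : r != 0 by rewrite gt_eqF.
have lxn : lx != 0 by rewrite gt_eqF.
have lyn : ly != 0 by rewrite gt_eqF.
(* Everything is expressed through [x - xbar], [w] and [d], so that the claim
   becomes a linear identity between their inner products. *)
have yE : y = 2^-1 *: (w + r *: d).
  by apply/rowP => i; rewrite /w /d /a !mxE; field.
have uE : u - xbar = (x - xbar) - (2 * r)^-1 *: w + 2^-1 *: d.
  by apply/rowP => i; rewrite /w /d /a !mxE; field; rewrite rn.
have x'E : x' - xbar = (x - xbar) - (lx / (2 * r)) *: w.
  by apply/rowP => i; rewrite /x' /w !mxE; field; rewrite rn.
have y'E : y' = y - (ly * r / 2) *: d.
  by apply/rowP => i; rewrite /y' /d /a !mxE; field; rewrite rn.
rewrite uE x'E y'E; move: yE; clearbody w d => ->.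
move: (x - xbar) => e H; rewrite -subr_ge0.
move: H; rewrite !dotE (dotC d w) (dotC e w) => H.
apply: (le_trans H); rewrite le_eqVlt; apply/orP; left; apply/eqP.
field.
by rewrite rn lyn lxn.
Qed.

(** * Stability of solutions *)

(** A limit of solutions of perturbed variational inequalities solves the QVI
    as soon as the parameters [a] of the constraint sets have the same limit.
    Each [v] in [K z] is the limit of some [b k] in [K (a k)], at which the
    [k]-th inequality can be tested. *)
Lemma VI_sol_limit {R : realType} {n : nat} {F : 'rV[R]_n -> 'rV[R]_n}
    {K : 'rV[R]_n -> set 'rV[R]_n} {a u w : nat -> 'rV[R]_n} {z : 'rV[R]_n} :
  continuous F -> inner_semicontinuous K -> closed (gph K) ->
  a @ \oo --> z -> u @ \oo --> z -> w @ \oo --> (0 : 'rV[R]_n) ->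
  (forall k, VI_sol (fun v => F v - w k) (K (a k)) (u k)) -> QVI_sol F K z.
Proof.
move=> cF isc clK az uz w0 VI.
have Kz : K z z.
  have auz : (fun k => (a k, u k)) @ \oo --> (z, z) by exact: (cvg_pair az uz).
  apply: (closed_cvg (gph K) clK _ _ auz).
  by apply: nearW => k; exact: (VI k).1.
split=> // v Kv.
have [b [bv bK]] := isc z a v (ex_intro _ z Kz) az Kv.
have lim : (fun k => dot (F (u k) - w k) (b k - u k)) @ \oo --> dot (F z) (v - z).
  rewrite -[F z]subr0; apply: cvg_dot; apply: cvgB => //.
  exact: (cvg_comp _ _ uz (cF z)).
apply: (closed_cvg [set t : R | 0 <= t] (@closed_ge R 0) _ _ lim).
by apply: nearW => k; exact: (VI k).2.
Qed.

Lemma M_QVI0 {R : realType} {n : nat} (F : 'rV[R]_n -> 'rV[R]_n)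
    (K : 'rV[R]_n -> set 'rV[R]_n) : M_QVI F K 0 0 = QVI_sol F K.
Proof.
apply/seteqP; split=> u.
  case=> v; rewrite addr0 add0r => -[uK vN] /addr0_eq/eqP.
  rewrite eqr_oppLR => /eqP Fu; split=> // z /vN.
  by rewrite Fu dotNl oppr_ge0.
move=> [uK Fu]; exists (- F u); last by rewrite add0r subrr.
rewrite addr0; split=> // z /Fu; by rewrite dotNl oppr_le0.
Qed.

(** * Convergence of the algorithm *)

Section Algorithm.
Context {R : realType} {n : nat}.
Context {F : 'rV[R]_n -> 'rV[R]_n} {K : 'rV[R]_n -> set 'rV[R]_n}.
Context {xbar : 'rV[R]_n} {mu muperp r lx ly : R}.
Context {x y xhat : nat -> 'rV[R]_n}.
Hypothesis halg : PD_plus_QVI F K r lx ly x y xhat.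

Let a k := x k - r^-1 *: y k.
Let w k := y k + r *: x k - r *: xhat k.

(** The regularized operator of the subproblem takes the value
    [F (xhat k) - w k] at the solution, so the regularization can be replaced
    by the constant perturbation [w k], which vanishes in the limit. *)
Lemma PD_VI_sol k : VI_sol (fun z => F z - w k) (K (a k)) (xhat k).
Proof.
have [[Ka VI] _ _] := halg k; split=> // z /VI.
suff -> : F (xhat k) + r *: xhat k - y k - r *: x k = F (xhat k) - w k by [].
by rewrite /w; apply/rowP => i; rewrite !mxE; ring.
Qed.

Hypothesis hT : semimonotone (diag_space R n) muperp mu (T_QVI F K)
  (row_mx xbar xbar) 0 setT.
Hypotheses (hmuperp : 0 < muperp) (hr : muperp < r < mu^-1).
Hypotheses (hlx : 0 < lx < 2 * (1 - r * mu))
  (hly : 0 < ly < 2 * (1 - muperp / r)).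

Lemma PD_bounded_residuals :
  [/\ exists M, forall k, `|x k - xbar| <= M,
      w @ \oo --> (0 : 'rV[R]_n) &
      (fun k => xhat k - a k) @ \oo --> (0 : 'rV[R]_n)].
Proof.
have r0 : 0 < r by case/andP: hr => + _; exact: lt_trans.
have [lx0 lxu] := andP hlx; have [ly0 lyu] := andP hly.
pose V k := r / lx * dot (x k - xbar) (x k - xbar)
            + (ly * r)^-1 * dot (y k) (y k).
pose c1 := (2 * (1 - r * mu) - lx) / (4 * r).
pose c2 := r * (2 * (1 - muperp / r) - ly) / 4.
have c10 : 0 < c1 by rewrite divr_gt0 ?subr_gt0// mulr_gt0.
have c20 : 0 < c2 by rewrite divr_gt0// mulr_gt0// subr_gt0.
have rlx0 : 0 < r / lx by rewrite divr_gt0.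
have lyr0 : 0 < (ly * r)^-1 by rewrite invr_gt0 mulr_gt0.
have V0 k : 0 <= V k by rewrite addr_ge0// mulr_ge0 ?dot_ge0// ltW.
have w2 k : 0 <= c1 * dot (w k) (w k) by rewrite mulr_ge0 ?dot_ge0// ltW.
have d2 k : 0 <= c2 * dot (xhat k - a k) (xhat k - a k).
  by rewrite mulr_ge0 ?dot_ge0// ltW.
have desc k : V k.+1 + c1 * dot (w k) (w k)
              + c2 * dot (xhat k - a k) (xhat k - a k) <= V k.
  rewrite /V; have [_ -> ->] := halg k; apply: PD_descent => //.
  exact: semimonotone_diag hT _ _ _ (PD_VI_sol k).
have Vle k : V k <= V 0%N.
  elim: k => // k; apply: le_trans; apply: le_trans (desc k).
  by rewrite -addrA lerDl addr_ge0.
split.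
- exists (Num.sqrt (lx / r * V 0%N)) => k.
  rewrite (le_trans (norm_le_enorm _))// ler_wsqrtr//.
  rewrite -[lx / r]invrK invf_div ler_pdivlMl//.
  by rewrite (le_trans _ (Vle k))// lerDl mulr_ge0 ?dot_ge0// ltW.
- apply: cvg_dot_self0.
  apply: (decrement_cvg0 c10 V0) => k; first exact: dot_ge0.
  by rewrite (le_trans _ (desc k))// lerDl.
- apply: cvg_dot_self0.
  apply: (decrement_cvg0 c20 V0) => k; first exact: dot_ge0.
  by rewrite (le_trans _ (desc k))// lerD2r lerDl.
Qed.

Hypotheses (hF : continuous F) (hKisc : inner_semicontinuous K)
  (hKgph : closed (gph K)).

Lemma PD_cluster_QVI_sol z : cluster (x @ \oo) z -> QVI_sol F K z.
Proof.
move=> /cluster_subsequence[f [foo xz]].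
have r0 : r != 0 by rewrite gt_eqF//; case/andP: hr => + _; exact: lt_trans.
have [_ w0 d0] := PD_bounded_residuals.
have wf := cvg_comp _ _ foo w0; have df := cvg_comp _ _ foo d0.
have yf : y \o f @ \oo --> (0 : 'rV[R]_n).
  have -> : y \o f = (fun k => 2^-1 *: (w (f k) + r *: (xhat (f k) - a (f k)))).
    by apply/funext => k; apply/rowP => i; rewrite /w /a !mxE /=; field.
  have -> : (0 : 'rV[R]_n) = 2^-1 *: (0 + r *: 0).
    by rewrite add0r !scaler0.
  by apply: cvgZr; apply: cvgD => //; apply: cvgZr.
have af : a \o f @ \oo --> z.
  have -> : z = z - r^-1 *: 0 by rewrite scaler0 subr0.
  by apply: cvgB => //; apply: cvgZr.
have uf : xhat \o f @ \oo --> z.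
  have -> : xhat \o f = (fun k => (xhat (f k) - a (f k)) + a (f k)).
    by apply/funext => k; rewrite subrK.
  by rewrite -[z]add0r; apply: cvgD.
apply: (VI_sol_limit hF hKisc hKgph af uf wf) => k.
exact: PD_VI_sol.
Qed.

Lemma PD_cvg : QVI_sol F K = [set xbar] -> x @ \oo --> xbar.
Proof.
move=> uniq; have [[M xM] _ _] := PD_bounded_residuals.
by apply: (bounded_cluster_sub1_cvg xM); rewrite -uniq; apply: PD_cluster_QVI_sol.
Qed.

End Algorithm.

Theorem theorem5p2 (R : realType) (n : nat)
    (F : 'rV[R]_n -> 'rV[R]_n) (K : 'rV[R]_n -> set 'rV[R]_n)
    (xbar : 'rV[R]_n) (mu muperp r lx ly : R)
    (hF : continuous F)
    (hKisc : inner_semicontinuous K)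
    (hKgph : closed (gph K))
    (hKclosed : forall u, closed (K u))
    (hKconvex : forall u, convex_set (K u))
    (hKdom : dom K = setT)
    (hKF : (forall u, compact (K u)) \/ monotone_map F)
    (hxbar : QVI_sol F K xbar)
    (hmu : 0 < mu) (hmuperp : 0 < muperp) (hmumu : mu * muperp < 1)
    (hT : semimonotone (diag_space R n) muperp mu (T_QVI F K)
            (row_mx xbar xbar) 0 setT)
    (hr : muperp < r < mu^-1)
    (hlx : 0 < lx < 2 * (1 - r * mu))
    (hly : 0 < ly < 2 * (1 - muperp / r))
    (x y xhat : nat -> 'rV[R]_n)
    (halg : PD_plus_QVI F K r lx ly x y xhat) :
  (single_valued (M_VI F K) ->
   (exists Lp Lq : R, [/\ 0 <= Lp, 0 <= Lq, Lq < 1 / 2 &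
      forall p q u v, M_VI F K p q u -> M_VI F K 0 xbar v ->
        enorm (u - v) <= Lp * enorm p + Lq * enorm (q - xbar)]) ->
   ((exists k, QVI_sol F K (x k)) \/
    (bounded_set (range x) /\
     forall z, cluster (x @ \oo) z -> QVI_sol F K z)) /\
   (QVI_sol F K = [set xbar] -> x @ \oo --> xbar))
  /\
  (single_valued (M_QVI F K) ->
   (exists Lp Lq : R, [/\ 0 <= Lp, 0 <= Lq, Lq < 1 &
      forall p q u v, M_QVI F K p q u -> M_QVI F K 0 0 v ->
        enorm (u - v) <= Lp * enorm p + Lq * enorm q]) ->
   QVI_sol F K = [set xbar] /\
   ((exists k, QVI_sol F K (x k)) \/ x @ \oo --> xbar)).
Proof.
have bnd : bounded_set (range x).
  have [[M xM] _ _] := PD_bounded_residuals halg hT hmuperp hr hlx hly.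
  apply: (le_bounded_set _ (M + `|xbar|)) => _ [k _ <-] /=.
  by rewrite -(subrK xbar (x k)) (le_trans (ler_normD _ _))// lerD2r.
split=> [_ _|single _].
  split; last exact: (PD_cvg halg hT hmuperp hr hlx hly hF hKisc hKgph).
  right; split=> //.
  exact: (PD_cluster_QVI_sol halg hT hmuperp hr hlx hly hF hKisc hKgph).
have uniq : QVI_sol F K = [set xbar].
  have [v] := single 0 0; rewrite M_QVI0 => Sv.
  by rewrite Sv; move: hxbar; rewrite Sv => <-.
by split=> //; right; apply: (PD_cvg halg hT hmuperp hr hlx hly hF hKisc hKgph).
Qed.
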